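(* Let $p,q\ge0$ be integers and let $\alpha_r,a_r$ ($1\le r\le p$) and $\beta_r,b_r$ ($1\le r\le q$) be positive real numbers. Put $\kappa=\sum_{r=1}^q\beta_r-\sum_{r=1}^p\alpha_r$ and $h=\prod_{r=1}^p\alpha_r^{\alpha_r}\prod_{r=1}^q\beta_r^{-\beta_r}$, and assume $\kappa\ge1$. Then the series $$I(x)=\sum_{n\ge0}\frac{\prod_{r=1}^p\Gamma(\alpha_rn+a_r)}{\prod_{r=1}^q\Gamma(\beta_rn+b_r)}x^n$$ is superpolynomially peaked near $n=(hx)^{1/\kappa}$.
   Context: $\Gamma$ is Euler's Gamma function. A real sequence $(c_n)_{n\ge1}$ increases subpolynomially if it is increasing (in the weak sense), $c_n\le Bn$ for some $B>0$, and $\lim_{n\to\infty}c_n/n^s=0$ for all $s>0$. A series $I(x)=\sum_{n\ge0}A_nx^n$ that converges absolutely on $(-\infty,\infty)$ is superpolynomially peaked near $n=f(x)$ if for every subpolynomially increasing sequence $c_n$ and every integer $k\ge0$, $$\lim_{x\to\infty}\frac{\sum_{n\ge1}A_nc_n\log(n)^kx^n-\sum_{n\ge1}A_nc_nx^n\log(f(x))^k}{I(x)}=0.$$ *)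

(* Defs.v *)
From mathcomp Require Import all_boot all_order all_algebra.
From mathcomp Require Import all_classical all_reals all_analysis.
Import Order.TTheory GRing.Theory Num.Theory.
Import numFieldNormedType.Exports.

Set Implicit Arguments.
Unset Strict Implicit.
Unset Printing Implicit Defensive.

Local Open Scope classical_set_scope.
Local Open Scope ring_scope.

(* Euler's integral of the second kind; it is Gamma(x) for x > 0, and it
   diverges (so the value is meaningless) for x <= 0. *)
Definition Gamma (R : realType) (x : R) : R :=
  \int[@lebesgue_measure R]_(t in `]0, +oo[) (t `^ (x - 1) * expR (- t)).

(* Meaningful when the partial sums converge. *)
Definition sum_from (R : realType) (m : nat) (u : nat -> R) : R :=
  limn (fun N => \sum_(m <= n < N) u n).

(* The sequence is (c_n)_(n >= 1): the value c 0 plays no role. *)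
Definition subpoly_increasing (R : realType) (c : nat -> R) : Prop :=
  [/\ forall m n : nat, (1 <= m)%N -> (m <= n)%N -> c m <= c n,
      exists2 B : R, 0 < B & forall n : nat, (1 <= n)%N -> c n <= B * n%:R
    & forall s : R, 0 < s -> c n / n%:R `^ s @[n --> \oo] --> (0 : R)].

Definition entire_series (R : realType) (A : nat -> R) : Prop :=
  forall x : R, cvgn (series (fun n => `|A n * x ^+ n|)).

(* For c subpolynomially increasing, c n is O(n), so the two series in the
   numerator converge absolutely whenever entire_series A holds. *)
Definition superpoly_peaked (R : realType) (A : nat -> R) (f : R -> R) : Prop :=
  entire_series A /\
  forall (c : nat -> R) (k : nat), subpoly_increasing c ->
    (sum_from 1 (fun n => A n * c n * ln n%:R ^+ k * x ^+ n)
     - sum_from 1 (fun n => A n * c n * x ^+ n) * ln (f x) ^+ k)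
    / sum_from 0 (fun n => A n * x ^+ n) @[x --> +oo] --> (0 : R).

Definition gamma_coeff (R : realType) (p q : nat)
    (alpha a : 'I_p -> R) (beta b : 'I_q -> R) (n : nat) : R :=
  (\prod_(r < p) Gamma (alpha r * n%:R + a r))
  / \prod_(r < q) Gamma (beta r * n%:R + b r).

Definition gamma_kappa (R : realType) (p q : nat)
    (alpha : 'I_p -> R) (beta : 'I_q -> R) : R :=
  \sum_(r < q) beta r - \sum_(r < p) alpha r.

Definition gamma_h (R : realType) (p q : nat)
    (alpha : 'I_p -> R) (beta : 'I_q -> R) : R :=
  (\prod_(r < p) alpha r `^ alpha r) * \prod_(r < q) beta r `^ (- beta r).

(* Main.v *)
Require Import Defs.
From mathcomp Require Import all_boot all_order all_algebra.
From mathcomp Require Import all_classical all_reals all_analysis measurable_realfun.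
From mathcomp Require Import ring lra.
Import Order.TTheory GRing.Theory Num.Theory.
Import numFieldNormedType.Exports.

Set Implicit Arguments.
Unset Strict Implicit.
Unset Printing Implicit Defensive.

Local Open Scope classical_set_scope.
Local Open Scope ring_scope.

(* Tangent-line inequalities for powers, integrated against [Gamma], give
   [z `^ (1 + al) / (z + al) <= Gamma (z + al) / Gamma z <= (z + al) `^ al],
   so that [rho n = h * A n.-1 / A n] (with [rho 0 = 0]) satisfies
   [rho n = n `^ kappa + O(n `^ (kappa - 1))].  Put [y = h * x = f `^ kappa] and
   [t n = A n * x ^+ n].  Since [rho n.+1 * t n.+1 = y * t n], the mean of [rho]
   under the weights [t] is [y] and its variance telescopes to
   [y * \sum_n (rho n.+1 - rho n) * t n / \sum_n t n], whence [n / f - 1] has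
   second moment O(1 / f).  The differences
   [c n * (ln n ^+ k - ln f ^+ k)] are O(f `^ 4^-1 * (|w| + w ^+ 2)) with
   [w = n / f - 1], so the quotient in the definition of superpolynomial
   peakedness is O(f `^ (- 4^-1)). *)

(** * Integration over the open half-line *)

(** The integrand may blow up at 0, as [t^(z - 1)] does for [z < 1]. The fundamental theorem is
    therefore applied on the closed rays [A n], which increase to the open half-line, and monotone
    convergence, valid because [f] is nonnegative, gives the limit. *)
Lemma ge0_FTC_gt0 (R : realType) (F f : R -> R) (l0 l : R) :
  (forall t : R, 0 < t -> 0 <= f t) ->
  (forall t : R, 0 < t -> {for t, continuous f}) ->
  (forall t : R, 0 < t -> is_derive t 1 F (f t)) ->
  F t @[t --> 0^'+] --> l0 -> F t @[t --> +oo] --> l ->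
  (\int[@lebesgue_measure R]_(t in `]0%R, +oo[) (f t)%:E = (l - l0)%:E)%E.
Proof.
move=> f0 cf dF F0 Fy.
pose A (n : nat) : set R := `[n.+1%:R^-1, +oo[%classic.
have UA : (\bigcup_n A n = `]0%R, +oo[%classic)%classic.
  apply/seteqP; split => t /=.
    move=> [n _]; rewrite /A /= !in_itv /= !andbT => nt.
    by apply: lt_le_trans nt; rewrite invr_gt0.
  rewrite in_itv /= andbT => t0.
  exists (Num.truncn t^-1) => //; rewrite /A /= in_itv /= andbT.
  rewrite -[leRHS]invrK lef_pV2 ?posrE ?invr_gt0 //.
  by apply/ltW; rewrite Num.Theory.truncnS_gt.
have fA n : (\int[@lebesgue_measure R]_(t in A n) (f t)%:E
    = l%:E - (F n.+1%:R^-1)%:E)%E.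
  have a0 : (0 : R) < n.+1%:R^-1 by rewrite invr_gt0.
  apply: ge0_continuous_FTC2y => //.
  - by move=> x ax; apply: f0; apply: lt_le_trans ax.
  - apply/continuous_within_itvcyP; split.
      move=> x; rewrite in_itv /= andbT => ax; apply: cf; exact: lt_trans ax.
    by apply: cvg_at_right_filter; apply: cf.
  - by move=> x ax; apply: ex_derive; apply: dF; exact: lt_trans ax.
  - apply: cvg_at_right_filter; apply: differentiable_continuous.
    by apply/derivable1_diffP; apply: ex_derive; apply: dF.
  - move=> x; rewrite in_itv /= andbT => ax; rewrite derive1E; apply: derive_val.
    by apply: dF; exact: lt_trans ax.
have mf : measurable_fun (`]0%R, +oo[%classic : set R) f.
  apply: open_continuous_measurable_fun => //.
  by move=> x; rewrite inE /= in_itv /= andbT => x0; apply: cf.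
have cv : (\int[@lebesgue_measure R]_(t in A n) (f t)%:E @[n --> \oo]
    --> \int[@lebesgue_measure R]_(t in \bigcup_n A n) (f t)%:E)%classic%E.
  apply: (@ge0_nondecreasing_set_cvg_integral _ (measurableTypeR R) R A
    (EFin \o f) (@lebesgue_measure R)) => //.
  - move=> m n mn; apply/subsetPset => t; rewrite /A /= !in_itv /= !andbT => mt.
    by apply: le_trans mt; rewrite lef_pV2 ?posrE // ler_nat.
  - by move=> n; exact: measurable_itv.
  - move=> n; apply/measurable_EFinP; apply: measurable_funS mf => // t.
    rewrite /A /= !in_itv /= !andbT => nt.
    by apply: lt_le_trans nt; rewrite invr_gt0.
  - move=> n x; rewrite /A /= in_itv /= andbT => ax; rewrite lee_fin f0 //.
    by apply: lt_le_trans ax; rewrite invr_gt0.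
rewrite -UA; apply/esym; apply: cvg_unique cv => //.
rewrite (_ : (fun n => _) = fun n : nat => (l - F n.+1%:R^-1)%:E); last first.
  by apply/funext => n; rewrite fA EFinB.
apply: cvg_EFin; first by near=> n.
apply: cvgB; first exact: cvg_cst.
move: F0 => /cvg_at_rightP; apply; split=> [n|]; first by rewrite invr_gt0.
exact: cvg_harmonic.
Unshelve. all: end_near. Qed.

Lemma is_derive1_continuous (R : realType) (f : R -> R) (t d : R) :
  is_derive t 1 f d -> {for t, continuous f}.
Proof.
by move=> h; apply/differentiable_continuous/derivable1_diffP; exact: ex_derive.
Qed.

(** * The Gamma integral: convergence and functional equation *)

Lemma is_derive_expR_half (R : realType) (t : R) :
  is_derive t 1 (fun t : R => expR (- (t / 2))) (- 2^-1 * expR (- (t / 2))).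
Proof.
have h : is_derive t 1 (fun t : R => - (t / 2)) (- (2^-1)).
  rewrite (_ : (fun _ => _) = (- 2^-1) \*: id); last first.
    by apply/funext => u; rewrite /= /GRing.scale /= mulNr mulrC.
  by apply: is_derive_eq; rewrite /GRing.scale /= mulr1.
have {}h := @is_derive1_comp R expR (fun t : R => - (t / 2)) t _ _
  (is_derive_expR (- (t / 2))) h.
by apply: is_derive_eq h _; rewrite mulrC.
Qed.

Lemma cvgr_expR_half (R : realType) :
  expR (- (t / 2)) @[t --> +oo] --> (0 : R).
Proof.
apply: (cvg_comp (fun x : R => x / 2) (fun x => expR (- x))) (@cvgr_expR R).
by apply: gt0_cvgMly.
Qed.

(** Half of the exponential decay is kept as an integrable majorant. The other half gives
    [t^z * expR (- (t / 2))], largest at [t = 2 * z]; [ln u <= u - 1] at [u = t / (2 * z)] bounds it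
    by [(2 * z)^z], the witness. *)
Lemma gamma_integrand_bound (R : realType) (z : R) : 0 < z ->
  exists2 C : R, 0 < C & forall t : R, 0 < t ->
    t `^ z * expR (- t) <= C * expR (- (t / 2)).
Proof.
move=> z0; exists (expR (z * ln (2 * z))); first exact: expR_gt0.
move=> t t0; rewrite /powR gt_eqF // -!expRD ler_expR.
have u0 : 0 < t / (2 * z) by rewrite divr_gt0 ?mulr_gt0.
have : ln (t / (2 * z)) <= t / (2 * z) - 1.
  rewrite -[X in ln X](subrKC 1); apply: le_ln1Dx; lra.
rewrite ln_div ?posrE ?mulr_gt0 // => h.
have : z * (ln t - ln (2 * z)) <= z * (t / (2 * z) - 1) by rewrite ler_pM2l.
have -> : z * (t / (2 * z) - 1) = t / 2 - z by field; lra.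
rewrite mulrBr; lra.
Qed.

Lemma expR_half_integral (R : realType) :
  (\int[@lebesgue_measure R]_(t in `]0%R, +oo[) (expR (- (t / 2)))%:E
   = (2%R)%:E)%E.
Proof.
have dE (t : R) : is_derive t 1 (fun t => - 2 * expR (- (t / 2))) (expR (- (t / 2))).
  have := @is_deriveZ _ _ _ _ (-2) _ _ _ (is_derive_expR_half t).
  move=> h; apply: is_derive_eq h _.
  by rewrite /GRing.scale /=; lra.
apply: etrans (@ge0_FTC_gt0 R (fun t => - 2 * expR (- (t / 2)))
  (fun t => expR (- (t / 2))) (-2) 0 _ _ _ _ _) _.
- by move=> t _; exact: expR_ge0.
- by move=> t _; exact: is_derive1_continuous (is_derive_expR_half t).
- apply: cvg_at_right_filter.
  rewrite [X in _ --> X](_ : _ = -2 * expR (- (0 / 2)) :> R); last first.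
    by rewrite mul0r oppr0 expR0 mulr1.
  exact: is_derive1_continuous (dE 0).
- rewrite -[X in _ --> X](mulr0 (-2)); apply: cvgM; first exact: cvg_cst.
  exact: cvgr_expR_half.
- by congr _%:E; lra.
Qed.

Lemma is_derive_gamma_integrand (R : realType) (z t : R) : 0 < t ->
  is_derive t 1 (fun t => t `^ z * expR (- t))
    (z * t `^ (z - 1) * expR (- t) - t `^ z * expR (- t)).
Proof.
move=> t0.
have h1 := @is_derive1_powR R z t t0.
have h2 := @is_derive1_comp R expR -%R t _ _ (is_derive_expR (- t)) _.
have {}h2 := h2 _ (is_deriveN (is_derive_id t 1)).
refine (is_derive_eq (is_deriveM h1 h2) _).
by rewrite /GRing.scale /=; ring.
Qed.

Lemma gamma_integrand_continuous (R : realType) (z t : R) : 0 < t ->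
  {for t, continuous (fun t => t `^ z * expR (- t))}.
Proof.
by move=> t0; exact: is_derive1_continuous (is_derive_gamma_integrand z t0).
Qed.

Lemma gamma_integrand_measurable (R : realType) (z : R) :
  measurable_fun (`]0%R, +oo[%classic : set R) (fun t => t `^ z * expR (- t)).
Proof.
apply: open_continuous_measurable_fun => //.
by move=> x; rewrite inE /= in_itv /= andbT => x0; exact: gamma_integrand_continuous.
Qed.

(* The added multiple of [expR (- (t / 2))] makes the derivative of
   [t `^ z * expR (- t)] nonnegative, so that monotone convergence applies. *)
Lemma gamma_FTC (R : realType) (z C : R) : 0 < z ->
  (forall t : R, 0 < t -> t `^ z * expR (- t) <= C * expR (- (t / 2))) ->
  (\int[@lebesgue_measure R]_(t in `]0%R, +oo[)
     (z * (t `^ (z - 1) * expR (- t)) - t `^ z * expR (- t)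
      + C * expR (- (t / 2)))%:E = (2 * C)%:E)%E.
Proof.
move=> z0 hC.
have dE (t : R) : 0 < t ->
    is_derive t 1 (fun t => t `^ z * expR (- t) + - 2 * C * expR (- (t / 2)))
      (z * (t `^ (z - 1) * expR (- t)) - t `^ z * expR (- t)
       + C * expR (- (t / 2))).
  move=> t0; have h1 := is_derive_gamma_integrand z t0.
  have h2 := @is_deriveZ _ _ _ _ (-2 * C) _ _ _ (is_derive_expR_half t).
  refine (is_derive_eq (is_deriveD h1 h2) _).
  by rewrite /GRing.scale /=; field.
apply: etrans (@ge0_FTC_gt0 R _
  (fun t => z * (t `^ (z - 1) * expR (- t)) - t `^ z * expR (- t)
      + C * expR (- (t / 2))) (-2 * C) 0 _ _ dE _ _) _.
- move=> t t0; have := hC t t0.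
  have : 0 <= z * (t `^ (z - 1) * expR (- t)).
    by rewrite !mulr_ge0 ?powR_ge0 ?expR_ge0 // ltW.
  by lra.
- move=> t t0; apply: continuousD; first apply: continuousB.
  + apply: continuousM; first exact: cvg_cst.
    exact: gamma_integrand_continuous.
  + exact: gamma_integrand_continuous.
  + apply: continuousM; first exact: cvg_cst.
    exact: is_derive1_continuous (is_derive_expR_half t).
- rewrite [X in _ --> X](_ : _ = 0 * expR (- 0) + -2 * C * expR (- (0 / 2)) :> R);
    last by rewrite !mul0r oppr0 expR0; ring.
  apply: cvgD; last first.
    apply: cvgM; first exact: cvg_cst.
    apply: cvg_at_right_filter.
    exact: is_derive1_continuous (is_derive_expR_half 0).
  apply: cvgM; first exact: powR_cvg0.
  apply: cvg_at_right_filter.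
  apply: (cvg_comp -%R expR); last exact: continuous_expR.
  by apply: cvgN; exact: cvg_id.
- rewrite -[X in _ --> X](addr0 0); apply: cvgD; last first.
    rewrite -[X in _ --> X](mulr0 (-2 * C)); apply: cvgM; first exact: cvg_cst.
    exact: cvgr_expR_half.
  apply: (@squeeze_cvgr _ _ _ _ (fun=> 0) (fun t => C * expR (- (t / 2)))).
  + near=> t; have t0 : 0 < t by near: t; apply: nbhs_pinfty_gt; rewrite num_real.
    by rewrite hC // mulr_ge0 ?powR_ge0 ?expR_ge0.
  + exact: cvg_cst.
  + rewrite -[X in _ --> X](mulr0 C); apply: cvgM; first exact: cvg_cst.
    exact: cvgr_expR_half.
- by congr _%:E; ring.
Unshelve. all: end_near. Qed.

Lemma expR_half_integrable (R : realType) :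
  (@lebesgue_measure R).-integrable `]0%R, +oo[
    (fun t : R => (expR (- (t / 2)))%:E).
Proof.
apply/integrableP; split.
  apply/measurable_EFinP; apply: open_continuous_measurable_fun => // x _.
  exact: is_derive1_continuous (is_derive_expR_half x).
under eq_integral do rewrite /= ger0_norm ?expR_ge0 //.
by rewrite expR_half_integral ltry.
Qed.

Lemma gamma_integrand_integrable_pos (R : realType) (z : R) : 0 < z ->
  (@lebesgue_measure R).-integrable `]0%R, +oo[
    (fun t : R => (t `^ z * expR (- t))%:E).
Proof.
move=> z0; have [C C0 hC] := gamma_integrand_bound z0.
apply: (@le_integrable _ (measurableTypeR R) R _ _ _ _
  (fun t => C%:E * (expR (- (t / 2)))%:E)%E) => //.
- by apply/measurable_EFinP; exact: gamma_integrand_measurable.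
- move=> t /=; rewrite in_itv /= andbT => t0.
  rewrite lee_fin !ger0_norm ?hC // mulr_ge0 ?powR_ge0 ?expR_ge0 //.
  exact: ltW.
- by apply: integrableZl => //; exact: expR_half_integrable.
Qed.

(** The exponent [z - 1] may be negative, out of reach of [gamma_integrand_bound]. Instead, the
    nonnegative function [f] has the finite integral [2 * C] by [gamma_FTC], and
    [z * t^(z - 1) * expR (- t)] is at most [f t + t^z * expR (- t)]. *)
Lemma gamma_integrand_integrable (R : realType) (z : R) : 0 < z ->
  (@lebesgue_measure R).-integrable `]0%R, +oo[
    (fun t : R => (t `^ (z - 1) * expR (- t))%:E).
Proof.
move=> z0; have [C C0 hC] := gamma_integrand_bound z0.
pose f t : R := z * (t `^ (z - 1) * expR (- t)) - t `^ z * expR (- t)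
      + C * expR (- (t / 2)).
have f0 t : 0 < t -> 0 <= f t.
  move=> t0; have := hC t t0.
  have : 0 <= z * (t `^ (z - 1) * expR (- t)).
    by rewrite !mulr_ge0 ?powR_ge0 ?expR_ge0 // ltW.
  by rewrite /f; lra.
have intf : (@lebesgue_measure R).-integrable `]0%R, +oo[ (EFin \o f).
  apply/integrableP; split.
    apply/measurable_EFinP; apply: measurable_funD; first apply: measurable_funB.
    + by apply: measurable_funM => //; exact: gamma_integrand_measurable.
    + exact: gamma_integrand_measurable.
    + apply: measurable_funM => //.
      apply/measurable_EFinP; exact: measurable_int (expR_half_integrable R).
  rewrite (_ : (\int[_]_(x in _) _)%E = (2 * C)%:E) ?ltry //.
  rewrite -(gamma_FTC z0 hC); apply: eq_integral => t.
  by rewrite inE /= in_itv /= andbT => t0; rewrite ger0_norm // f0.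
apply: (@le_integrable _ (measurableTypeR R) R _ _ _ _
  (fun t => z^-1%:E * ((f t)%:E + (t `^ z * expR (- t))%:E))%E) => //.
- by apply/measurable_EFinP; exact: gamma_integrand_measurable.
- move=> t /=; rewrite in_itv /= andbT => t0.
  have e0 : 0 <= t `^ z * expR (- t) by rewrite mulr_ge0 ?powR_ge0 ?expR_ge0.
  have g0 : 0 <= t `^ (z - 1) * expR (- t) by rewrite mulr_ge0 ?powR_ge0 ?expR_ge0.
  rewrite lee_fin !ger0_norm //; last first.
    by apply: mulr_ge0; [rewrite invr_ge0 ltW|apply: addr_ge0 => //; exact: f0].
  rewrite ler_pdivlMl // /f.
  have : 0 <= C * expR (- (t / 2)) by rewrite mulr_ge0 ?expR_ge0 // ltW.
  by lra.
- apply: integrableZl => //; apply: integrableD => //.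
  exact: gamma_integrand_integrable_pos.
Qed.

(** Integration by parts: once the integral in [gamma_FTC] is split, the auxiliary exponential
    contributes [2 * C], which cancels the right-hand side. *)
Lemma GammaS (R : realType) (z : R) : 0 < z -> Gamma (z + 1) = z * Gamma z.
Proof.
move=> z0; have [C C0 hC] := gamma_integrand_bound z0.
have ig := gamma_integrand_integrable z0.
have ig1 := gamma_integrand_integrable_pos z0.
have izg : (@lebesgue_measure R).-integrable `]0%R, +oo[
    (EFin \o (fun t => z * (t `^ (z - 1) * expR (- t)))).
  exact: (integrableZl _ z ig).
have ie : (@lebesgue_measure R).-integrable `]0%R, +oo[
    (EFin \o (fun t => C * expR (- (t / 2)))).
  exact: (integrableZl _ C (expR_half_integrable R)).
have iB : (@lebesgue_measure R).-integrable `]0%R, +oo[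
    (EFin \o (fun t => z * (t `^ (z - 1) * expR (- t)) - t `^ z * expR (- t))).
  exact: (integrableB _ izg ig1).
have := congr1 fine (gamma_FTC z0 hC).
rewrite -/(Rintegral _ _ _) RintegralD //.
rewrite RintegralB // !RintegralZl //; last exact: expR_half_integrable.
rewrite [X in C * X]/Rintegral expR_half_integral /=.
have -> : Gamma (z + 1) =
    \int[@lebesgue_measure R]_(t in `]0%R, +oo[) (t `^ z * expR (- t)).
  by rewrite /Gamma addrK.
rewrite -/(Gamma z); lra.
Qed.

(** * Two-sided bounds for ratios of Gamma values *)

Lemma Gamma_comb_le (R : realType) (x y z a b : R) : 0 < x -> 0 < y -> 0 < z ->
  (forall t : R, 0 < t -> a * t `^ (x - 1) + b * t `^ (y - 1) <= t `^ (z - 1)) ->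
  a * Gamma x + b * Gamma y <= Gamma z.
Proof.
move=> x0 y0 z0 h.
have ix := gamma_integrand_integrable x0.
have iy := gamma_integrand_integrable y0.
have iz := gamma_integrand_integrable z0.
have iax : (@lebesgue_measure R).-integrable `]0%R, +oo[
    (EFin \o (fun t => a * (t `^ (x - 1) * expR (- t)))).
  exact: (integrableZl _ a ix).
have iby : (@lebesgue_measure R).-integrable `]0%R, +oo[
    (EFin \o (fun t => b * (t `^ (y - 1) * expR (- t)))).
  exact: (integrableZl _ b iy).
have iD : (@lebesgue_measure R).-integrable `]0%R, +oo[
    (EFin \o (fun t => a * (t `^ (x - 1) * expR (- t))
                       + b * (t `^ (y - 1) * expR (- t)))).
  exact: (integrableD _ iax iby).
rewrite /Gamma -!RintegralZl // -RintegralD //.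
apply: le_Rintegral => // t /=; rewrite in_itv /= andbT => t0.
by rewrite !mulrA -mulrDl ler_pM2r ?expR_gt0 // h.
Qed.

Lemma powR_ge1Dln (R : realType) (u al : R) : 0 < u -> 1 + al * ln u <= u `^ al.
Proof. by move=> u0; rewrite /powR gt_eqF // expR_ge1Dx. Qed.

Lemma ln_le_subr1 (R : realType) (u : R) : 0 < u -> ln u <= u - 1.
Proof. by move=> u0; rewrite -[X in ln X](subrKC 1); apply: le_ln1Dx; lra. Qed.

Lemma ln_ge_1subV (R : realType) (u : R) : 0 < u -> 1 - u^-1 <= ln u.
Proof.
move=> u0; have := @ln_le_subr1 R u^-1; rewrite invr_gt0 lnV ?posrE // => /(_ u0).
by lra.
Qed.

(** With [s = z + al], the tangent at [t = s] of the convex function [(s / t)^al] is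
    [1 + al - al * t / s]. Multiplied by [t^(s - 1) / s^al] and integrated, using
    [Gamma (s + 1) = s * Gamma s], it leaves exactly [Gamma s / s^al]. *)
Lemma Gamma_addr_le (R : realType) (z al : R) : 0 < z -> 0 < al ->
  Gamma (z + al) <= (z + al) `^ al * Gamma z.
Proof.
move=> z0 al0; set s := z + al.
have s0 : 0 < s by rewrite addr_gt0.
have S0 : 0 < s `^ al by rewrite powR_gt0.
have := @Gamma_comb_le R s (s + 1) z ((1 + al) / s `^ al)
  (- (al / s) / s `^ al) s0 (addr_gt0 s0 ltr01) z0 _.
rewrite GammaS // => H.
have : (1 + al) / s `^ al * Gamma s + - (al / s) / s `^ al * (s * Gamma s)
    <= Gamma z.
  apply: H => t t0.
  have -> : t `^ (s - 1) = t `^ (z - 1) * t `^ al.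
    by rewrite -powRD ?(gt_eqF t0) ?implybT // /s; congr (_ `^ _); ring.
  have -> : t `^ (s + 1 - 1) = t `^ (z - 1) * t `^ al * t.
    rewrite -powRD ?(gt_eqF t0) ?implybT //.
    rewrite -[X in _ = _ * X](powRr1 (ltW t0)) -powRD ?(gt_eqF t0) ?implybT //.
    by rewrite /s; congr (_ `^ _); ring.
  set P := t `^ (z - 1); set T := t `^ al; set S := s `^ al in S0 *.
  have P0 : 0 < P by rewrite powR_gt0.
  have T0 : 0 < T by rewrite powR_gt0.
  have key : 1 + al - al * t / s <= S / T.
    have -> : S / T = (s / t) `^ al.
      rewrite powRM ?invr_ge0 ?ltW //; congr (_ * _).
      by rewrite -[t^-1]powR_inv1 ?ltW // -powRrM mulN1r powRN.
    have st0 : 0 < s / t by rewrite divr_gt0.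
    apply: le_trans (powR_ge1Dln al st0).
    have := ln_ge_1subV st0; rewrite invf_div => h.
    have : al * (1 - t / s) <= al * ln (s / t) by rewrite ler_pM2l.
    by rewrite mulrBr mulrA; lra.
  have {}key : P * T / S * (1 + al - al * t / s) <= P * T / S * (S / T).
    by rewrite ler_pM2l // divr_gt0 // mulr_gt0.
  rewrite (_ : P * T / S * (S / T) = P) in key; last first.
    by field; rewrite !gt_eqF.
  apply: le_trans key; rewrite le_eqVlt; apply/orP; left; apply/eqP.
  by field; rewrite !gt_eqF.
rewrite (_ : _ + _ = Gamma s / s `^ al); last by field; rewrite !gt_eqF.
by rewrite ler_pdivrMr // mulrC.
Qed.

(** The same inequality [u^al >= 1 + al - al / u], now at [u = t / z]; unlike the tangent line of
    [u^al] itself, it is a lower bound for [al < 1] too. The weight contains [t^z] rather than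
    [t^(z - 1)], so that the term with [1 / t] yields [Gamma z] and not [Gamma (z - 1)]; hence the
    extra factors [z] and [z + al]. *)
Lemma Gamma_addr_ge (R : realType) (z al : R) : 0 < z -> 0 < al ->
  z `^ al * z * Gamma z <= (z + al) * Gamma (z + al).
Proof.
move=> z0 al0; set s := z + al.
have s0 : 0 < s by rewrite addr_gt0.
have S0 : 0 < z `^ al by rewrite powR_gt0.
have := @Gamma_comb_le R (z + 1) z (s + 1) (z `^ al * (1 + al))
  (- (z `^ al * al * z)) (addr_gt0 z0 ltr01) z0 (addr_gt0 s0 ltr01) _.
rewrite !GammaS // => H.
have : z `^ al * (1 + al) * (z * Gamma z) + - (z `^ al * al * z) * Gamma z
    <= s * Gamma s.
  apply: H => t t0.
  have -> : t `^ (z + 1 - 1) = t `^ (z - 1) * t.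
    rewrite -[X in _ = _ * X](powRr1 (ltW t0)) -powRD ?(gt_eqF t0) ?implybT //.
    by congr (_ `^ _); ring.
  have -> : t `^ (s + 1 - 1) = t `^ (z - 1) * t * t `^ al.
    rewrite -[X in _ = _ * X * _](powRr1 (ltW t0)) -!powRD ?(gt_eqF t0) ?implybT //.
    by rewrite /s; congr (_ `^ _); ring.
  set P := t `^ (z - 1); set T := t `^ al; set S := z `^ al in S0 *.
  have P0 : 0 < P by rewrite powR_gt0.
  have key : 1 + al - al * z / t <= T / S.
    have -> : T / S = (t / z) `^ al.
      rewrite powRM ?invr_ge0 ?ltW //; congr (_ * _).
      by rewrite -[z^-1]powR_inv1 ?ltW // -powRrM mulN1r powRN.
    have tz0 : 0 < t / z by rewrite divr_gt0.
    apply: le_trans (powR_ge1Dln al tz0).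
    have := ln_ge_1subV tz0; rewrite invf_div => h.
    have : al * (1 - z / t) <= al * ln (t / z) by rewrite ler_pM2l.
    by rewrite mulrBr mulrA; lra.
  have {}key : P * t * S * (1 + al - al * z / t) <= P * t * S * (T / S).
    by rewrite ler_pM2l // !mulr_gt0.
  rewrite (_ : P * t * S * (T / S) = P * t * T) in key; last first.
    by field; rewrite !gt_eqF.
  apply: le_trans key; rewrite le_eqVlt; apply/orP; left; apply/eqP.
  by field; rewrite !gt_eqF.
by apply: le_trans; rewrite le_eqVlt; apply/orP; left; apply/eqP; ring.
Qed.

Lemma Gamma1 (R : realType) : Gamma 1 = 1 :> R.
Proof.
have dN (t : R) : is_derive t 1 (fun t => expR (- t)) (- expR (- t)).
  have h := @is_derive1_comp R expR -%R t _ _ (is_derive_expR (- t))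
    (is_deriveN (is_derive_id t 1)).
  by refine (is_derive_eq h _); rewrite mulrN1.
have dF (t : R) : is_derive t 1 (fun t => - expR (- t)) (expR (- t)).
  by refine (is_derive_eq (is_deriveN (dN t)) _); rewrite opprK.
rewrite /Gamma /Rintegral.
under eq_integral do rewrite subrr powRr0 mul1r.
rewrite (@ge0_FTC_gt0 R (fun t => - expR (- t)) (fun t => expR (- t)) (-1) 0).
- by rewrite /= opprK add0r.
- by move=> t _; exact: expR_ge0.
- by move=> t _; exact: is_derive1_continuous (dN t).
- apply: cvg_at_right_filter.
  rewrite [X in _ --> X](_ : _ = - expR (- 0) :> R); last by rewrite oppr0 expR0.
  exact: is_derive1_continuous (dF 0).
- by rewrite -[X in _ --> X]oppr0; apply: cvgN; exact: cvgr_expR.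
Qed.

(** [Gamma_addr_ge] at the base point 1 with shift [z] gives [1 <= (z + 1) * Gamma (z + 1)], and
    [GammaS] carries the sign back to [z]. *)
Lemma Gamma_gt0 (R : realType) (z : R) : 0 < z -> 0 < Gamma z.
Proof.
move=> z0; have ? : 0 < z + 1 by rewrite addr_gt0.
have := Gamma_addr_ge ltr01 z0; rewrite powR1 !mul1r Gamma1 addrC => h1.
have : 0 < (z + 1) * Gamma (z + 1) by apply: lt_le_trans h1; exact: ltr01.
by rewrite pmulr_rgt0 // GammaS // pmulr_rgt0.
Qed.

(** * Asymptotics of the ratios of consecutive coefficients *)

Lemma ler_norm_lnB (R : realType) (x y m : R) : 0 < m -> m <= x -> m <= y ->
  `|ln x - ln y| <= `|x - y| / m.
Proof.
move=> m0.
wlog xy : x y / y <= x => [H mx my|].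
  have [yx|xy] := leP y x; first exact: H.
  by rewrite distrC [`|x - y|]distrC; apply: H => //; exact: ltW.
move=> mx my; have y0 : 0 < y by exact: lt_le_trans my.
have x0 : 0 < x by exact: lt_le_trans mx.
rewrite !ger0_norm ?subr_ge0 ?ler_ln ?posrE //.
rewrite -ln_div ?posrE //; apply: le_trans (ln_le_subr1 _) _; first exact: divr_gt0.
rewrite (_ : x / y - 1 = (x - y) / y); last by field; rewrite gt_eqF.
by rewrite ler_wpM2l ?subr_ge0 // lef_pV2 ?posrE.
Qed.

(** Put [z = al * n + a]. The logarithm of [Gamma (z + al) / Gamma z] lies between
    [(1 + al) * ln z - ln (z + al)] and [al * ln (z + al)]. The numbers [z], [z + al] and
    [al * (n + 1)] differ by at most [al + a] and are at least [min(al, a) * (n + 1)], so their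
    logarithms are within O(1 / (n + 1)) of each other. *)
Lemma ln_Gamma_ratio (R : realType) (al a : R) : 0 < al -> 0 < a ->
  exists2 C : R, 0 < C & forall n : nat,
    `|ln (Gamma (al * n.+1%:R + a)) - ln (Gamma (al * n%:R + a))
      - al * ln (al * n.+1%:R)| <= C / n.+1%:R.
Proof.
move=> al0 a0; pose m := Num.min al a.
have m0 : 0 < m by rewrite lt_min al0.
exists ((1 + al) * (al + a) / m); first by rewrite !mulr_gt0 ?invr_gt0 ?addr_gt0.
move=> n; set N : R := n.+1%:R.
have N1 : 1 <= N by rewrite ler1n.
have N0 : 0 < N by exact: lt_le_trans N1.
set z := al * n%:R + a.
have zE : al * N + a = z + al by rewrite /z /N -natr1; ring.
have mz : m * N <= z.
  rewrite /N -natr1 mulrDr mulr1 lerD // ?ge_min ?lexx ?orbT //.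
  by rewrite ler_wpM2r // ge_min lexx.
have z0 : 0 < z by apply: lt_le_trans mz; rewrite mulr_gt0.
have mN0 : 0 < m * N by rewrite mulr_gt0.
rewrite zE.
have s0 : 0 < z + al by rewrite addr_gt0.
have al1 : 0 < 1 + al by rewrite addr_gt0.
move: (Gamma_addr_le z0 al0) (Gamma_addr_ge z0 al0) (Gamma_gt0 z0) (Gamma_gt0 s0).
move: (Gamma (z + al)) (Gamma z) => g1 g0 U L g0_gt0 g1_gt0.
have {}U : ln g1 <= al * ln (z + al) + ln g0.
  by rewrite -ln_powR -lnM ?posrE ?powR_gt0 // ler_ln ?posrE ?mulr_gt0 ?powR_gt0.
have {}L : al * ln z + ln z + ln g0 <= ln (z + al) + ln g1.
  rewrite -ln_powR -!lnM ?posrE ?mulr_gt0 ?powR_gt0 //.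
  by rewrite ler_ln ?posrE ?mulr_gt0 ?powR_gt0.
have mN : m * N <= al * N by rewrite ler_wpM2r ?ge_min ?lexx // ltW.
have ms : m * N <= z + al by rewrite (le_trans mz) // lerDl ltW.
have B1 := ler_norm_lnB mN0 ms mN.
have B2 := ler_norm_lnB mN0 mz mN.
have B3 := ler_norm_lnB mN0 ms mz.
have D1 : `|z + al - al * N| <= al + a.
  by rewrite -zE addrAC subrr add0r ger0_norm ?lerDr ltW.
have D2 : `|z - al * N| <= al + a.
  have -> : z - al * N = a - al by rewrite -[z](addrK al) -zE; ring.
  by rewrite ler_norml; apply/andP; split; lra.
have D3 : `|z + al - z| <= al + a.
  by rewrite addrAC subrr add0r ger0_norm ?lerDl ltW.
have bd x : x <= al + a -> x / (m * N) <= (al + a) / (m * N).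
  by move=> h; rewrite ler_pM2r ?invr_gt0.
have {D1}B1 := le_trans B1 (bd _ D1).
have {D2}B2 := le_trans B2 (bd _ D2).
have {D3}B3 := le_trans B3 (bd _ D3).
have -> : (1 + al) * (al + a) / m / N = (1 + al) * ((al + a) / (m * N)).
  by field; rewrite !gt_eqF.
move: B1 B2 B3; set E := (al + a) / (m * N) => B1 B2 B3.
have E0 : 0 < E by rewrite divr_gt0 ?addr_gt0.
move: B1 B2 B3; rewrite !ler_norml => /andP[B1 B1'] /andP[B2 B2'] /andP[B3 B3'].
(* The lower bound costs one error for [al * ln z] and one for [ln z - ln (z + al)], whence the
   factor [1 + al] in the constant. *)
have M1 : al * (ln (z + al) - ln (al * N)) <= al * E by rewrite ler_pM2l.
have M2 : al * - E <= al * (ln z - ln (al * N)) by rewrite ler_pM2l.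
by apply/andP; split; lra.
Qed.

Lemma ln_prod (R : realType) (p : nat) (F : 'I_p -> R) : (forall r, 0 < F r) ->
  ln (\prod_(r < p) F r) = \sum_(r < p) ln (F r).
Proof.
move=> F0; suff [//] : 0 < \prod_(r < p) F r /\
  ln (\prod_(r < p) F r) = \sum_(r < p) ln (F r).
apply: (big_ind2 (fun x y : R => 0 < x /\ ln x = y)).
- by rewrite ln1.
- by move=> x1 x2 y1 y2 [? <-] [? <-]; rewrite mulr_gt0 // lnM.
- by [].
Qed.

(* Otherwise unification unfolds the integrals. *)
Local Opaque Gamma.

Lemma prodGamma_gt0 (R : realType) (p : nat) (al a : 'I_p -> R) (n : nat) :
  (forall r, 0 < al r) -> (forall r, 0 < a r) ->
  0 < \prod_(r < p) Gamma (al r * n%:R + a r).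
Proof.
move=> al0 a0; apply: prodr_gt0 => r _; apply: Gamma_gt0.
by rewrite ltr_wpDl // mulr_ge0 // ltW.
Qed.

Lemma ln_prodGamma_ratio (R : realType) (p : nat) (al a : 'I_p -> R) :
  (forall r, 0 < al r) -> (forall r, 0 < a r) ->
  exists2 C : R, 0 <= C & forall n : nat,
    `|ln (\prod_(r < p) Gamma (al r * n.+1%:R + a r))
      - ln (\prod_(r < p) Gamma (al r * n%:R + a r))
      - (\sum_(r < p) al r * ln (al r) + (\sum_(r < p) al r) * ln n.+1%:R)|
    <= C / n.+1%:R.
Proof.
move=> al0 a0.
have /choice[C hC] r : exists C : R, 0 < C /\ forall n : nat,
    `|ln (Gamma (al r * n.+1%:R + a r)) - ln (Gamma (al r * n%:R + a r))
      - al r * ln (al r * n.+1%:R)| <= C / n.+1%:R.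
  by have [C C0 h] := ln_Gamma_ratio (al0 r) (a0 r); exists C.
exists (\sum_r C r) => [|n].
  by apply: sumr_ge0 => r _; have [/ltW] := hC r.
have pos m r : 0 < Gamma (al r * m%:R + a r).
  by apply: Gamma_gt0; rewrite ltr_wpDl // mulr_ge0 // ltW.
rewrite !ln_prod // mulr_suml -big_split -!sumrB mulr_suml /=.
apply: le_trans (ler_norm_sum _ _ _) _; apply: ler_sum => r _.
have [_ /(_ n)] := hC r.
by rewrite lnM ?posrE // mulrDr.
Qed.

Lemma gamma_h_gt0 (R : realType) (p q : nat) (alpha : 'I_p -> R)
    (beta : 'I_q -> R) :
  (forall r, 0 < alpha r) -> (forall r, 0 < beta r) -> 0 < gamma_h alpha beta.
Proof.
by move=> h1 h2; apply: mulr_gt0; apply: prodr_gt0 => r _; rewrite powR_gt0.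
Qed.

Lemma gamma_coeff_gt0 (R : realType) (p q : nat)
    (alpha a : 'I_p -> R) (beta b : 'I_q -> R) (n : nat) :
  (forall r, 0 < alpha r) -> (forall r, 0 < a r) ->
  (forall r, 0 < beta r) -> (forall r, 0 < b r) ->
  0 < gamma_coeff alpha a beta b n.
Proof. by move=> *; rewrite divr_gt0 // prodGamma_gt0. Qed.

(** The logarithm of [gamma_h] is the sum of [alpha r * ln (alpha r)] minus that of
    [beta r * ln (beta r)]. It cancels the constant part of the logarithmic ratio of the Gamma
    products, so that only the [gamma_kappa] term and the error survive. *)
Lemma ln_gamma_coeff_ratio (R : realType) (p q : nat)
    (alpha a : 'I_p -> R) (beta b : 'I_q -> R) :
  (forall r, 0 < alpha r) -> (forall r, 0 < a r) ->
  (forall r, 0 < beta r) -> (forall r, 0 < b r) ->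
  let A := gamma_coeff alpha a beta b in
  exists2 C : R, 0 <= C & forall n : nat,
    `|ln (gamma_h alpha beta * A n / A n.+1)
      - gamma_kappa alpha beta * ln n.+1%:R| <= C / n.+1%:R.
Proof.
move=> al0 a0 be0 b0 A.
have [C C0 hC] := ln_prodGamma_ratio al0 a0.
have [D D0 hD] := ln_prodGamma_ratio be0 b0.
exists (C + D) => [|n]; first exact: addr_ge0.
have h0 := gamma_h_gt0 al0 be0.
have A0 m : 0 < A m by exact: gamma_coeff_gt0.
have lnE x y z : 0 < x -> 0 < y -> 0 < z -> ln (x * y / z) = ln x + ln y - ln z :> R.
  by move=> x0 y0 z0; rewrite ln_div ?posrE ?mulr_gt0 // lnM.
rewrite lnE // /A /gamma_coeff !ln_div ?posrE ?prodGamma_gt0 //.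
have -> : ln (gamma_h alpha beta) =
    \sum_r alpha r * ln (alpha r) - \sum_r beta r * ln (beta r).
  rewrite lnM ?posrE ?prodr_gt0 // => [|r _|r _]; rewrite ?powR_gt0 //.
  rewrite !ln_prod => [|r|r]; rewrite ?powR_gt0 //.
  rewrite -sumrN; congr (_ + _); apply: eq_bigr => r _.
    by rewrite ln_powR.
  by rewrite ln_powR mulNr.
have combine (x0 x1 y0 y1 u v s t l c d : R) :
    `|x1 - x0 - (u + s * l)| <= c -> `|y1 - y0 - (v + t * l)| <= d ->
    `|u - v + (x0 - y0) - (x1 - y1) - (t - s) * l| <= c + d.
  by rewrite !ler_norml => /andP[h1 h2] /andP[h3 h4]; apply/andP; split; lra.
rewrite [(C + D) / _]mulrDl; refine (combine _ _ _ _ _ _ _ _ _ _ _ (hC n) (hD n)).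
Qed.

Lemma ler_norm_expR_sub1 (R : realType) (x : R) :
  `|expR x - 1| <= `|x| * expR `|x|.
Proof.
have h1 := expR_ge1Dx x; have h2 := expR_ge1Dx (- x).
have e0 := expR_gt0 x.
have : expR x * (1 + - x) <= expR x * expR (- x) by rewrite ler_pM2l.
rewrite -expRD subrr expR0 => h3.
have [x0|x0] := leP 0 x.
  by rewrite (ger0_norm x0) ger0_norm; lra.
rewrite (ltr0_norm x0) ler0_norm; last by rewrite subr_le0 ltW // expR_lt1.
have e1 : 1 <= expR (- x) by rewrite ltW // expR_gt1 oppr_gt0.
have : - x * 1 <= - x * expR (- x) by rewrite ler_wpM2l // oppr_ge0 ltW.
by lra.
Qed.

(** Exponentiates the estimate: [rho = N^kap * expR e] with [|e| <= C / N <= C], hence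
    [|expR e - 1| <= C / N * expR C]. The factor [1 / N] lowers the exponent to [kap - 1]. *)
Lemma powR_ratio_of_ln (R : realType) (N kap rho C : R) :
  1 <= N -> 0 < rho -> 0 <= C -> `|ln rho - kap * ln N| <= C / N ->
  `|rho - N `^ kap| <= C * expR C * N `^ (kap - 1).
Proof.
move=> N1 rho0 C0; have N0 : 0 < N by exact: lt_le_trans N1.
set e := ln rho - kap * ln N => he.
have -> : rho = N `^ kap * expR e.
  by rewrite /powR gt_eqF // -expRD /e addrC subrK lnK.
have -> : N `^ kap * expR e - N `^ kap = N `^ kap * (expR e - 1) by ring.
rewrite normrM ger0_norm ?powR_ge0 // powRB; last by rewrite (gt_eqF N0) implybT.
rewrite powRr1 ?(ltW N0) //.
rewrite (_ : C * expR C * _ = N `^ kap * (C / N * expR C)); last by ring.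
rewrite ler_wpM2l ?powR_ge0 //; apply: le_trans (ler_norm_expR_sub1 e) _.
apply: ler_pM => //; rewrite ?expR_ge0 // ler_expR (le_trans he) //.
by rewrite ler_pdivrMr // ler_peMr.
Qed.

(** * Convergence of the power series *)

Lemma cvgn_series_ratio (R : realType) (u : nat -> R) (n0 : nat) :
  (forall n, 0 <= u n) -> (forall n, (n0 <= n)%N -> u n.+1 <= u n / 2) ->
  cvgn (series u).
Proof.
move=> u0 hu.
have nd : {homo series u : n m / (n <= m)%N >-> n <= m}.
  by apply/nondecreasing_seqP => n; rewrite seriesSr lerDl u0.
apply: nondecreasing_is_cvgn => //.
(* The quantity [series u n + 2 * u n] does not increase from [n0] on, which bounds the partial
   sums. *)
have H n : series u (n0 + n)%N + 2 * u (n0 + n)%N <= series u n0 + 2 * u n0.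
  elim: n => [|n IH]; first by rewrite addn0.
  apply: le_trans IH; rewrite addnS seriesSr.
  by have := hu (n0 + n)%N (leq_addr _ _); lra.
exists (series u n0 + 2 * u n0) => _ [n _ <-].
apply: le_trans (nd _ _ (leq_addl n0 n)) _; apply: le_trans (H n).
by rewrite lerDl mulr_ge0.
Qed.

Lemma entire_series_of_ratio (R : realType) (A : nat -> R) (h kap K : R) :
  (forall n, 0 < A n) -> 0 < h -> 1 <= kap -> 0 <= K ->
  (forall n, `|h * A n / A n.+1 - n.+1%:R `^ kap| <= K * n.+1%:R `^ (kap - 1)) ->
  entire_series A.
Proof.
move=> A0 h0 k1 K0 hA x.
(* For [n + 1 > y] the hypothesis gives [h * A n / A n.+1 >= (n + 1)^(kap - 1) * (n + 1 - K) >= 2 *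
   h * |x|], since [kap >= 1]; thus each term is at most half the one before. *)
pose y : R := K + 2 * h * `|x|.
have y0 : 0 <= y by rewrite addr_ge0 // !mulr_ge0 // ltW.
apply: (@cvgn_series_ratio _ _ (Num.truncn y)) => // n yn.
have yN : y < n.+1%:R by rewrite -truncn_lt_nat.
have N1 : (1 : R) <= n.+1%:R by rewrite ler1n.
have N0 : (0 : R) < n.+1%:R by rewrite ltr0n.
have P1 : 1 <= n.+1%:R `^ (kap - 1) :> R.
  by rewrite -[leLHS](powRr0 n.+1%:R) ler_powR // subr_ge0.
have lower : 2 * h * `|x| <= h * A n / A n.+1.
  have := hA n; rewrite ler_norml => /andP[+ _].
  rewrite -(@mulr_powRB1 _ _ kap (ltW N0)); last exact: lt_le_trans ltr01 k1.
  set P := _ `^ _ in P1 * => hl.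
  have : 1 * (2 * h * `|x|) <= P * (n.+1%:R - K).
    apply: ler_pM => //; first by rewrite !mulr_ge0 // ltW.
    by rewrite /y in yN; lra.
  by lra.
rewrite exprS !normrM mulrCA mulrC.
rewrite (_ : `|A n| * _ / 2 = `|x ^+ n| * (`|A n| / 2)); last by ring.
rewrite [leLHS](_ : _ = `|x ^+ n| * (`|A n.+1| * `|x|)); last by ring.
rewrite ler_wpM2l // !(gtr0_norm (A0 _)).
rewrite ler_pdivlMr // in lower.
rewrite -(ler_pM2l h0); lra.
Qed.

(** * The second moment of [n / f - 1] *)

(* For infinite sums the boundary terms vanish, and this is the formula for the
   variance of [rho] under the weights [t]. *)
Lemma sum_sqr_deviation (R : realType) (rho t : nat -> R) (y : R) (N : nat) :
  rho 0%N = 0 -> (forall n, rho n.+1 * t n.+1 = y * t n) ->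
  \sum_(0 <= n < N.+1) (rho n - y) ^+ 2 * t n =
  \sum_(0 <= n < N) y * (rho n.+1 - rho n) * t n + y ^+ 2 * t N - y * rho N * t N.
Proof.
move=> r0 ht; elim: N => [|N IH].
  by rewrite big_nat1 big_geq // r0; ring.
rewrite big_nat_recr //= IH big_nat_recr //=.
have := ht N; move: (rho N.+1) (t N.+1) (rho N) (t N) => r' t' r u e.
have -> : (r' - y) ^+ 2 * t' = r' * (r' * t') - 2 * y * (r' * t') + y ^+ 2 * t' by ring.
rewrite -[y * r' * t']mulrA e; ring.
Qed.

(** Bernoulli's inequality for real exponents: for [u > 0], multiply
    [u^(k - 1) >= 1 + (k - 1) * (1 - 1 / u)] by [u]. *)
Lemma powR_ge1D (R : realType) (u k : R) : 0 <= u -> 1 <= k ->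
  1 + k * (u - 1) <= u `^ k.
Proof.
rewrite le_eqVlt => /orP[/eqP <- k1|u0 k1].
  by rewrite powR0; lra.
rewrite -(@mulr_powRB1 _ _ k (ltW u0)); last lra.
have h := powR_ge1Dln (k - 1) u0; have l := ln_ge_1subV u0.
have k0 : 0 <= k - 1 by lra.
have : (k - 1) * (1 - u^-1) <= (k - 1) * ln u by rewrite ler_wpM2l.
move=> H; have {}h : 1 + (k - 1) * (1 - u^-1) <= u `^ (k - 1) by lra.
have : u * (1 + (k - 1) * (1 - u^-1)) <= u * u `^ (k - 1) by rewrite ler_pM2l.
apply: le_trans; rewrite le_eqVlt; apply/orP; left; apply/eqP.
by field; rewrite gt_eqF.
Qed.

(** Transfers moment bounds from [(n / f)^kap - 1] to [n / f - 1]: a power with exponent at least 1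
    moves [u] no closer to 1. *)
Lemma ler_norm_powR_sub1 (R : realType) (u k : R) : 0 <= u -> 1 <= k ->
  `|u - 1| <= `|u `^ k - 1|.
Proof.
move=> u0 k1; have [u1|u1] := leP 1 u.
  have := le1r_powR u1 k1 => h; rewrite !ger0_norm; lra.
have h : u `^ k <= u.
  have [<-|u0'] := eqVneq 0 u; first by rewrite powR0; lra.
  by apply: ge1r_powR => //; rewrite lt_neqAle u0' u0 ltW.
rewrite !ler0_norm; lra.
Qed.

(** Serves to express errors of order [n^(kap - 1)] through [f] and the deviation of [n] from [f].
    For [x > f] it comes from [(x / f)^(k - 1) <= (x / f)^k]. *)
Lemma powR_subr1_le (R : realType) (x f k : R) : 0 <= x -> 1 <= f -> 1 <= k ->
  x `^ (k - 1) <= f `^ (k - 1) * (1 + `|(x / f) `^ k - 1|).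
Proof.
move=> x0 f1 k1; have f0 : 0 < f by exact: lt_le_trans f1.
have P0 : 0 <= f `^ (k - 1) by exact: powR_ge0.
have [xf|fx] := leP x f.
  apply: (@le_trans _ _ (f `^ (k - 1))); last by rewrite ler_peMr // lerDl.
  by apply: ge0_ler_powR => //; rewrite ?subr_ge0 // nnegrE ltW.
have u1 : 1 <= x / f by rewrite ler_pdivlMr // mul1r ltW.
have -> : x = f * (x / f) by field; rewrite gt_eqF.
rewrite [X in _ <= _ * (1 + `|X `^ _ - 1|)](_ : _ = x / f); last first.
  by field; rewrite gt_eqF.
rewrite powRM ?(ltW f0) ?(le_trans ler01 u1) // ler_wpM2l //.
apply: (@le_trans _ _ ((x / f) `^ k)); first by apply: ler_powR => //; lra.
by rewrite ger0_norm; [lra|rewrite subr_ge0 -[leLHS](powRr0 (x / f)) ler_powR //; lra].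
Qed.

(** Rests on [m + 1 <= 2 * max(m, f)], which holds because [f >= 1]; a comparison with [m] alone
    would fail at [m = 0]. *)
Lemma powR_succ_subr1_le (R : realType) (m : nat) (f k : R) : 1 <= f -> 1 <= k ->
  m.+1%:R `^ (k - 1)
    <= 2 `^ (k - 1) * (f `^ (k - 1) * (1 + `|(m%:R / f) `^ k - 1|)).
Proof.
move=> f1 k1; have f0 : 0 < f by exact: lt_le_trans f1.
have P0 : 0 <= f `^ (k - 1) by exact: powR_ge0.
have k0 : 0 <= k - 1 by rewrite subr_ge0.
have [mf|fm] := leP m%:R f.
  apply: (@le_trans _ _ (2 `^ (k - 1) * f `^ (k - 1))); last first.
    by rewrite ler_wpM2l ?powR_ge0 // ler_peMr // lerDl.
  rewrite -powRM ?(ltW f0) //; apply: ge0_ler_powR => //; rewrite ?nnegrE ?mulr_ge0 ?(ltW f0) //.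
  by rewrite -natr1; lra.
apply: (@le_trans _ _ (2 `^ (k - 1) * m%:R `^ (k - 1))); last first.
  by rewrite ler_wpM2l ?powR_ge0 // powR_subr1_le.
rewrite -powRM //; apply: ge0_ler_powR => //; rewrite ?nnegrE ?mulr_ge0 //.
by rewrite -natr1; lra.
Qed.

(** Bernoulli's inequality at [u = m / (m + 1)], multiplied by [(m + 1)^k]. *)
Lemma powR_succ_sub_le (R : realType) (m : nat) (k : R) : 1 <= k ->
  m.+1%:R `^ k - m%:R `^ k <= k * m.+1%:R `^ (k - 1).
Proof.
move=> k1; have N0 : (0 : R) < m.+1%:R by rewrite ltr0n.
have := @powR_ge1D R (m%:R / m.+1%:R) k _ k1.
rewrite divr_ge0 // => /(_ isT).
have -> : (m%:R / m.+1%:R) `^ k = m%:R `^ k / m.+1%:R `^ k.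
  rewrite powRM ?invr_ge0 //; congr (_ * _).
  by rewrite -[m.+1%:R^-1]powR_inv1 // -powRrM mulN1r powRN.
rewrite ler_pdivlMr ?powR_gt0 // -(@mulr_powRB1 _ _ k (ltW N0)); last first.
  exact: lt_le_trans k1.
set P := _ `^ (k - 1).
have -> : (1 + k * (m%:R / m.+1%:R - 1)) * (m.+1%:R * P) =
    m.+1%:R * P - k * P.
  by rewrite -natr1; field; rewrite natr1 gt_eqF.
lra.
Qed.

(** The constant is chosen before [f] and [t], so the bound is uniform as [f] grows; the boundary
    term in [t N] vanishes in the limit for a convergent series. The estimate is first proved for
    [W n], the deviation of [(n / f)^kap] from 1. There the errors bring back the unknown sum [S] of
    [W n ^+ 2 * t n] with a small factor, and it is absorbed. *)
Lemma second_moment_bound (R : realType) (kap K : R) (rho : nat -> R) :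
  1 <= kap -> 0 <= K -> rho 0%N = 0 -> (forall n, 0 <= rho n) ->
  (forall n, `|rho n - n%:R `^ kap| <= K * n%:R `^ (kap - 1)) ->
  exists2 C : R, 0 <= C & forall (f : R) (t : nat -> R),
    1 <= f -> C <= f -> (forall n, 0 <= t n) ->
    (forall n, rho n.+1 * t n.+1 = f `^ kap * t n) ->
    forall N, \sum_(0 <= n < N.+1) (n%:R / f - 1) ^+ 2 * t n <=
      C / f * \sum_(0 <= n < N.+1) t n + 4 * t N.
Proof.
move=> k1 K0 r0 rge0 hr.
(* The two summands of [C1] come from the increments of [rho] and from the distance between [rho n]
   and [n^kap]. *)
pose Q : R := 2 `^ (kap - 1); pose C1 := 4 * (kap + 2 * K) * Q + 4 * K ^+ 2.
have Q0 : 0 <= Q by exact: powR_ge0.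
have C10 : 0 <= C1.
  by rewrite addr_ge0 // ?mulr_ge0 ?addr_ge0 ?mulr_ge0 ?sqr_ge0 //; lra.
exists (2 * C1) => [|f t f1 Cf t0 ht N]; first by rewrite mulr_ge0.
have f0 : 0 < f by exact: lt_le_trans f1.
have k0 : 0 < kap by exact: lt_le_trans k1.
pose y := f `^ kap; have y0 : 0 < y by exact: powR_gt0.
pose W n := `|(n%:R / f) `^ kap - 1|.
have W0 n : 0 <= W n by exact: normr_ge0.
have yE : y = f * f `^ (kap - 1) by rewrite mulr_powRB1 // ltW.
have pE n : n%:R `^ kap = y * (n%:R / f) `^ kap.
  by rewrite -powRM ?(ltW f0) ?divr_ge0 ?(ltW f0) //; congr (_ `^ _); field; rewrite gt_eqF.
(* An increment of [rho] is at most that of [n^kap] plus two errors, each at most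
   [K * (n + 1)^(kap - 1)]. *)
have step n : rho n.+1 - rho n <= (kap + 2 * K) * Q * (y / f) * (1 + W n).
  have h1 := powR_succ_subr1_le n f1 k1.
  have h2 := @powR_succ_sub_le R n kap k1.
  have h3 : n%:R `^ (kap - 1) <= n.+1%:R `^ (kap - 1) :> R.
    by apply: ge0_ler_powR; rewrite ?nnegrE ?ler_nat //; lra.
  have := hr n; have := hr n.+1; rewrite !ler_norml => /andP[_ h4] /andP[h5 _].
  have h6 : K * n%:R `^ (kap - 1) <= K * n.+1%:R `^ (kap - 1) by rewrite ler_wpM2l.
  apply: (@le_trans _ _ ((kap + 2 * K) * n.+1%:R `^ (kap - 1))); first lra.
  rewrite -!mulrA ler_wpM2l //; first by rewrite addr_ge0 ?mulr_ge0 // ltW.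
  apply: le_trans h1 _; rewrite le_eqVlt; apply/orP; left; apply/eqP.
  by rewrite /Q /W yE; field; rewrite gt_eqF.
(* Here [y * W n = |n^kap - y|] is split at [rho n], with [(a + b)^2 <= 2 * a^2 + 2 * b^2]. *)
have dev n : (W n) ^+ 2 * y ^+ 2 <=
    2 * (rho n - y) ^+ 2 + 2 * (K ^+ 2 * (y / f * (1 + W n)) ^+ 2).
  have -> : W n ^+ 2 * y ^+ 2 = (n%:R `^ kap - y) ^+ 2.
    by rewrite pE real_normK ?num_real //; ring.
  have h1 := @powR_subr1_le R n%:R f kap (ler0n _ _) f1 k1.
  have h2 : `|rho n - n%:R `^ kap| <= K * (y / f * (1 + W n)).
    apply: le_trans (hr n) _; rewrite ler_wpM2l //; apply: le_trans h1 _.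
    by rewrite le_eqVlt; apply/orP; left; apply/eqP; rewrite /W yE; field; rewrite gt_eqF.
  have h3 : (rho n - n%:R `^ kap) ^+ 2 <= (K * (y / f * (1 + W n))) ^+ 2.
    rewrite -[leLHS]real_normK ?num_real // ler_sqr ?nnegrE //.
    by apply: le_trans h2.
  rewrite exprMn in h3.
  have := sqr_ge0 (n%:R `^ kap - rho n + (y - rho n)).
  rewrite !expr2 in h3 *; lra.
pose S := \sum_(0 <= n < N.+1) W n ^+ 2 * t n.
pose T := \sum_(0 <= n < N.+1) t n.
have S0 : 0 <= S by apply: sumr_ge0 => n _; rewrite mulr_ge0 ?sqr_ge0.
have T0 : 0 <= T by apply: sumr_ge0 => n _.
have onesq n : (1 + W n) ^+ 2 <= 2 * (1 + W n ^+ 2).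
  by have := sqr_ge0 (1 - W n); rewrite !expr2; lra.
have one n : 1 + W n <= 2 * (1 + W n ^+ 2).
  by apply: le_trans (onesq n); rewrite expr2 ler_peMl ?lerDl // addr_ge0.
have TS : \sum_(0 <= n < N.+1) (1 + W n ^+ 2) * t n = T + S.
  by rewrite /T /S -big_split /=; apply: eq_bigr => n _; ring.
have c0 : 0 <= (kap + 2 * K) * Q * (y / f).
  by rewrite !mulr_ge0 ?addr_ge0 ?mulr_ge0 ?invr_ge0 // ltW.
have V : \sum_(0 <= n < N.+1) (rho n - y) ^+ 2 * t n <=
    y * ((kap + 2 * K) * Q * (y / f)) * (2 * (T + S)) + y ^+ 2 * t N.
  (* Of the two boundary terms, [- y * rho N * t N] is nonpositive and is dropped. *)
  rewrite sum_sqr_deviation // -addrA; apply: lerD; last first.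
    by rewrite gerBl !mulr_ge0 // ltW.
  apply: (@le_trans _ _ (\sum_(0 <= n < N.+1)
      y * ((kap + 2 * K) * Q * (y / f)) * (2 * ((1 + W n ^+ 2) * t n)))).
    rewrite [leRHS]big_nat_recr //= -[leLHS]addr0; apply: lerD; last first.
      apply: mulr_ge0; first by apply: mulr_ge0 => //; exact: ltW.
      by rewrite !mulr_ge0 ?addr_ge0 ?sqr_ge0.
    apply: ler_sum => n _.
    have h : rho n.+1 - rho n <= (kap + 2 * K) * Q * (y / f) * (2 * (1 + W n ^+ 2)).
      by apply: le_trans (step n) _; rewrite ler_wpM2l.
    have : y * t n * (rho n.+1 - rho n) <=
        y * t n * ((kap + 2 * K) * Q * (y / f) * (2 * (1 + W n ^+ 2))).
      by apply: ler_wpM2l h; rewrite mulr_ge0 // ltW.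
    move: ((kap + 2 * K) * Q * (y / f)) => c; lra.
  by rewrite -mulr_sumr -mulr_sumr TS.
have U : y ^+ 2 * S <= 2 * \sum_(0 <= n < N.+1) (rho n - y) ^+ 2 * t n
    + 2 * (K ^+ 2 * (y / f) ^+ 2) * (2 * (T + S)).
  rewrite -TS /S !mulr_sumr -big_split /=; apply: ler_sum => n _.
  have h1 := dev n; have h2 := onesq n.
  have h3 : 2 * (K ^+ 2 * (y / f) ^+ 2) * (1 + W n) ^+ 2
      <= 2 * (K ^+ 2 * (y / f) ^+ 2) * (2 * (1 + W n ^+ 2)).
    apply: ler_wpM2l => //; apply: mulr_ge0 => //.
    by apply: mulr_ge0; exact: sqr_ge0.
  rewrite exprMn in h1.
  have : W n ^+ 2 * y ^+ 2 * t n <= (2 * (rho n - y) ^+ 2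
      + 2 * (K ^+ 2 * (y / f) ^+ 2) * (2 * (1 + W n ^+ 2))) * t n.
    by rewrite ler_wpM2r //; lra.
  lra.
have {U V}US : S <= C1 / f * (T + S) + 2 * t N.
  rewrite -(ler_pM2l (_ : 0 < y ^+ 2)); last by rewrite exprn_gt0.
  apply: le_trans U _.
  have ff : (y / f) ^+ 2 <= y ^+ 2 / f.
    rewrite expr_div_n ler_wpM2l ?sqr_ge0 // lef_pV2 ?posrE ?exprn_gt0 //.
    by rewrite expr2 ler_peMl // ltW.
  have : 4 * (K ^+ 2 * (T + S)) * (y / f) ^+ 2 <= 4 * (K ^+ 2 * (T + S)) * (y ^+ 2 / f).
    apply: ler_wpM2l ff; apply: mulr_ge0 => //.
    by apply: mulr_ge0; [exact: sqr_ge0|exact: addr_ge0].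
  have -> : y ^+ 2 * (C1 / f * (T + S) + 2 * t N) =
    2 * (y * ((kap + 2 * K) * Q * (y / f)) * (2 * (T + S)) + y ^+ 2 * t N) +
     4 * (K ^+ 2 * (T + S)) * (y ^+ 2 / f) by rewrite /C1; field; rewrite gt_eqF.
  lra.
(* Since [2 * C1 <= f], at most half of [S] stands on the right; moving it to the left doubles the
   other constants. *)
have half : C1 / f <= 1 / 2 by rewrite ler_pdivrMr //; lra.
have {}US : S <= 2 * C1 / f * T + 4 * t N.
  have : C1 / f * S <= 1 / 2 * S by rewrite ler_wpM2r.
  have -> : 2 * C1 / f * T = 2 * (C1 / f * T) by ring.
  lra.
apply: le_trans US; apply: ler_sum => n _; rewrite ler_wpM2r //.
rewrite -[leLHS]real_normK ?num_real // ler_sqr ?nnegrE //.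
by apply: ler_norm_powR_sub1 => //; rewrite divr_ge0 // ltW.
Qed.

(** * Growth of [c n] and of powers of logarithms *)

Lemma subpoly_increasing_bound (R : realType) (c : nat -> R) (s : R) :
  0 < s -> subpoly_increasing c ->
  exists2 C : R, 0 <= C & forall n : nat, (1 <= n)%N -> `|c n| <= C * n%:R `^ s.
Proof.
move=> s0 [_ _ /(_ s s0) hc].
have /cvg_seq_bounded/pinfty_ex_gt0[M M0 hM] : cvgn (fun n => c n / n%:R `^ s).
  by apply: cvgP hc.
exists M => [|n n1]; first exact: ltW.
have := hM n I; rewrite /= normrM normfV (ger0_norm (powR_ge0 _ _)).
by rewrite ler_pdivrMr // powR_gt0 // ltr0n.
Qed.

(** From [1 + d * ln u <= u^d] and [d <= 1] follows [1 + ln u <= u^d / d], which is raised to the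
    power [k + 1] with [d = s / (k + 1)]. Taking [k + 1] instead of [k] avoids a division by zero at
    [k = 0]. *)
Lemma ln_pow_bound (R : realType) (k : nat) (s : R) : 0 < s -> s <= 1 ->
  exists2 C : R, 0 <= C & forall u : R, 1 <= u -> (1 + ln u) ^+ k <= C * u `^ s.
Proof.
move=> s0 s1; pose d := s / k.+1%:R.
have K0 : (0 : R) < k.+1%:R by rewrite ltr0n.
have K1 : (1 : R) <= k.+1%:R by rewrite ler1n.
have d0 : 0 < d by rewrite divr_gt0.
have d1 : d <= 1 by rewrite ler_pdivrMr // mul1r (le_trans s1).
exists (d^-1 ^+ k.+1) => [|u u1]; first by rewrite exprn_ge0 // invr_ge0 ltW.
have l0 := ln_ge0 u1; have u0 : 0 < u by exact: lt_le_trans u1.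
have h : 1 + ln u <= d^-1 * u `^ d.
  by rewrite ler_pdivlMl //; apply: le_trans (powR_ge1Dln d u0); lra.
apply: (@le_trans _ _ ((1 + ln u) ^+ k.+1)).
  by apply: ler_weXn2l => //; lra.
have -> : u `^ s = (u `^ d) ^+ k.+1.
  by rewrite -powR_mulrn ?powR_ge0 // -powRrM /d divfK // gt_eqF.
by rewrite -exprMn; apply: lerXn2r; rewrite ?nnegrE ?mulr_ge0 ?powR_ge0 ?invr_ge0 ?(ltW d0) //; lra.
Qed.

Lemma ler_norm_exprB (R : realDomainType) (k : nat) (a b L : R) :
  0 <= a <= L -> 0 <= b <= L ->
  `|a ^+ k - b ^+ k| <= k%:R * (1 + L) ^+ k * `|a - b|.
Proof.
move=> /andP[a0 aL] /andP[b0 bL]; have L0 : 0 <= L by exact: le_trans aL.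
elim: k => [|k IH]; first by rewrite !expr0 subrr normr0 !mul0r.
have -> : a ^+ k.+1 - b ^+ k.+1 = a * (a ^+ k - b ^+ k) + (a - b) * b ^+ k.
  by rewrite !exprS; ring.
apply: le_trans (ler_normD _ _) _; rewrite !normrM (ger0_norm a0).
rewrite [`|b ^+ k|]ger0_norm ?exprn_ge0 //.
have P0 : 0 <= (1 + L) ^+ k by rewrite exprn_ge0 // addr_ge0.
have h1 : a * `|a ^+ k - b ^+ k| <= L * (k%:R * (1 + L) ^+ k * `|a - b|).
  by apply: ler_pM.
have h2 : `|a - b| * b ^+ k <= `|a - b| * (1 + L) ^+ k.
  rewrite ler_wpM2l //; apply: lerXn2r; rewrite ?nnegrE ?addr_ge0 //.
  by rewrite (le_trans bL) // lerDr.
have h3 : 0 <= `|a - b| * (1 + L) ^+ k * (k%:R + L).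
  by rewrite !mulr_ge0 // addr_ge0.
rewrite exprS -natr1; lra.
Qed.

(** For [x >= f / 2] this is the Lipschitz bound of [ln] on that range. Otherwise
    [|x / f - 1| >= 1 / 2], while the difference of logarithms is at most [ln f <= ln M]. *)
Lemma ln_sub_bound (R : realType) (x f M : R) : 1 <= x -> 1 <= f -> f <= M ->
  `|ln x - ln f| <= 2 * (1 + ln M) * `|x / f - 1|.
Proof.
move=> x1 f1 fM.
have f0 : 0 < f by exact: lt_le_trans f1.
have x0 : 0 < x by exact: lt_le_trans x1.
have lf := ln_ge0 f1; have lx := ln_ge0 x1.
have lM : ln f <= ln M by rewrite ler_ln ?posrE //; exact: lt_le_trans fM.
have [fx|xf] := leP (f / 2) x.
  have f2 : 0 < f / 2 by rewrite divr_gt0.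
  have f2f : f / 2 <= f by lra.
  apply: le_trans (ler_norm_lnB f2 fx f2f) _.
  rewrite (_ : `|x - f| / (f / 2) = 2 * `|x / f - 1|); last first.
    rewrite (_ : x - f = f * (x / f - 1)); last by field; rewrite gt_eqF.
    by rewrite normrM gtr0_norm //; field; rewrite gt_eqF.
  rewrite -mulrA ler_wpM2l // ler_peMl //; lra.
have w : x / f <= 1 / 2 by rewrite ler_pdivrMr //; lra.
have wn : 1 / 2 <= `|x / f - 1| by rewrite ler0_norm; lra.
have lxf : ln x <= ln f by rewrite ler_ln ?posrE //; lra.
rewrite ler0_norm ?subr_le0 //.
have : 2 * (1 + ln M) * (1 / 2) <= 2 * (1 + ln M) * `|x / f - 1|.
  by rewrite ler_wpM2l //; lra.
lra.
Qed.

(** [M = f * (1 + |w|)] dominates both [n] and [f]. The factor [c n] and the [k + 1] logarithmic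
    factors, one of them from [ln_sub_bound], cost [M^(1/8)] each, and together at most
    [f^(1/4) * (1 + |w|)]. The exponent 1/4 stays below 1/2, the rate at which [w] decays in mean
    square. *)
Lemma pointwise_bound (R : realType) (c : nat -> R) (k : nat) :
  subpoly_increasing c ->
  exists2 C : R, 0 <= C & forall (f : R) (n : nat), 1 <= f -> (1 <= n)%N ->
    `|c n * ln n%:R ^+ k - c n * ln f ^+ k| <=
    C * f `^ 4^-1 * (`|n%:R / f - 1| + (n%:R / f - 1) ^+ 2).
Proof.
move=> sc.
have s0 : (0 : R) < 8^-1 by rewrite invr_gt0.
have s1 : (8^-1 : R) <= 1 by rewrite invf_le1 // ler1n.
have [C1 C10 h1] := subpoly_increasing_bound s0 sc.
have [C2 C20 h2] := ln_pow_bound k.+1 s0 s1.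
exists (2 * k%:R * C1 * C2) => [|f n f1 n1]; first by rewrite !mulr_ge0.
have f0 : 0 < f by exact: lt_le_trans f1.
have N1 : (1 : R) <= n%:R by rewrite ler1n.
set w := n%:R / f - 1; pose M := f * (1 + `|w|).
have fM : f <= M by rewrite ler_peMr ?lerDl // ltW.
have M1 : 1 <= M by exact: le_trans fM.
have M0 : 0 < M by exact: lt_le_trans M1.
have nM : n%:R <= M.
  have -> : n%:R = f * (1 + w) :> R by rewrite /w; field; rewrite gt_eqF.
  by rewrite ler_pM2l // lerD2l ler_norm.
have lM := ln_ge0 M1.
have := @ler_norm_exprB R k (ln n%:R) (ln f) (ln M).
rewrite !ln_ge0 // !ler_ln ?posrE ?(lt_le_trans ltr01) // nM fM => /(_ isT isT) h3.
have h4 := ln_sub_bound N1 f1 fM; rewrite -/w in h4.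
have h5 := h2 M M1.
have h6 : `|c n| <= C1 * M `^ 8^-1.
  apply: le_trans (h1 n n1) _; rewrite ler_wpM2l //.
  by apply: ge0_ler_powR; rewrite ?nnegrE // ltW.
have h7 : M `^ 8^-1 * M `^ 8^-1 <= f `^ 4^-1 * (1 + `|w|).
  rewrite -powRD ?(gt_eqF M0) ?implybT //.
  have -> : 8^-1 + 8^-1 = 4^-1 :> R by field.
  rewrite powRM ?addr_ge0 ?(ltW f0) // ler_wpM2l ?powR_ge0 //.
  by apply: ler1_powR; [rewrite lerDl | rewrite invf_le1 // ler1n].
rewrite -mulrBr normrM.
have P0 : 0 <= (1 + ln M) ^+ k by rewrite exprn_ge0 // addr_ge0.
have h8 : `|ln n%:R ^+ k - ln f ^+ k| <= 2 * k%:R * `|w| * (1 + ln M) ^+ k.+1.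
  apply: le_trans h3 _.
  have : k%:R * (1 + ln M) ^+ k * `|ln n%:R - ln f| <=
     k%:R * (1 + ln M) ^+ k * (2 * (1 + ln M) * `|w|).
    by rewrite ler_wpM2l // mulr_ge0.
  move/le_trans; apply; rewrite exprS le_eqVlt; apply/orP; left; apply/eqP; ring.
have kw0 : 0 <= 2 * k%:R * `|w| by rewrite !mulr_ge0.
have {h5}h8 : `|ln n%:R ^+ k - ln f ^+ k| <= 2 * k%:R * `|w| * (C2 * M `^ 8^-1).
  by apply: le_trans h8 _; rewrite ler_wpM2l.
have : `|c n| * `|ln n%:R ^+ k - ln f ^+ k| <=
    C1 * M `^ 8^-1 * (2 * k%:R * `|w| * (C2 * M `^ 8^-1)) by apply: ler_pM.
move/le_trans; apply.
have -> : C1 * M `^ 8^-1 * (2 * k%:R * `|w| * (C2 * M `^ 8^-1)) =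
  2 * k%:R * C1 * C2 * `|w| * (M `^ 8^-1 * M `^ 8^-1) by ring.
have : 2 * k%:R * C1 * C2 * `|w| * (M `^ 8^-1 * M `^ 8^-1) <=
   2 * k%:R * C1 * C2 * `|w| * (f `^ 4^-1 * (1 + `|w|)).
  by rewrite ler_wpM2l // !mulr_ge0.
move/le_trans; apply; rewrite -[w ^+ 2]real_normK ?num_real //.
by rewrite le_eqVlt; apply/orP; left; apply/eqP; ring.
Qed.

(** A crude bound that makes the series in the numerator converge: the two square roots multiply to
    [n], and [n <= 2 ^+ n]. *)
Lemma subpoly_mul_ln_bound (R : realType) (c : nat -> R) (k : nat) :
  subpoly_increasing c ->
  exists2 C : R, 0 <= C & forall n : nat, (1 <= n)%N ->
    `|c n * ln n%:R ^+ k| <= C * 2 ^+ n.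
Proof.
move=> sc; have s0 : (0 : R) < 2^-1 by rewrite invr_gt0.
have s1 : (2^-1 : R) <= 1 by rewrite invf_le1 // ler1n.
have [C1 C10 h1] := subpoly_increasing_bound s0 sc.
have [C2 C20 h2] := ln_pow_bound k s0 s1.
exists (C1 * C2) => [|n n1]; first exact: mulr_ge0.
have N1 : (1 : R) <= n%:R by rewrite ler1n.
have N0 : (0 : R) < n%:R by rewrite ltr0n.
have l0 := ln_ge0 N1.
rewrite normrM [`|_ ^+ k|]ger0_norm ?exprn_ge0 //.
have hl : ln n%:R ^+ k <= C2 * n%:R `^ 2^-1 :> R.
  apply: le_trans (h2 _ N1); apply: lerXn2r; rewrite ?nnegrE ?addr_ge0 //; lra.
apply: (@le_trans _ _ (C1 * n%:R `^ 2^-1 * (C2 * n%:R `^ 2^-1))).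
  by apply: ler_pM => //; [exact: exprn_ge0|exact: h1].
rewrite mulrACA -powRD ?(gt_eqF N0) ?implybT //.
rewrite (_ : 2^-1 + 2^-1 = 1) ?powRr1 ?(ltW N0) //; last by field.
rewrite ler_wpM2l ?mulr_ge0 // -natrX ler_nat.
by apply/ltnW/ltn_expl.
Qed.

(** * Passage to the limit in the quotient *)

(** Comparison with the series at [2 * x], which absorbs the factor [2 ^+ n]. *)
Lemma entire_series_mul_cvg (R : realType) (A u : nat -> R) (C x : R) :
  entire_series A -> (forall n, (1 <= n)%N -> `|u n| <= C * 2 ^+ n) ->
  cvgn (fun N => \sum_(1 <= n < N) A n * u n * x ^+ n).
Proof.
move=> eA hu.
(* The value 0 at index 0 makes [series v] agree with the sums that start at 1. *)
pose v n := if n is 0%N then 0 else A n * u n * x ^+ n.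
have -> : (fun N => \sum_(1 <= n < N) A n * u n * x ^+ n) = series v.
  apply/funext => -[|N]; first by rewrite seriesEnat /= !big_geq.
  rewrite seriesEnat /= [RHS]big_ltn //= add0r; apply: eq_big_nat => -[|n] //.
apply: normed_cvg.
have C0 : 0 <= C.
  by have := le_trans (normr_ge0 _) (hu 1%N isT); rewrite pmulr_lge0.
apply: (@series_le_cvg _ _ (fun n => C * `|A n * (2 * x) ^+ n|)).
- by move=> n; exact: normr_ge0.
- by move=> n; exact: mulr_ge0.
- case=> [|n] /=; first by rewrite normr0 mulr_ge0.
  rewrite exprMn !normrM !normrX (ger0_norm (ler0n _ 2)).
  have := hu n.+1 isT; set X := `|x| ^+ _; set B := `|A _| => h.
  have : B * X * `|u n.+1| <= B * X * (C * 2 ^+ n.+1).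
    by apply: ler_wpM2l h; apply: mulr_ge0; rewrite /B /X ?exprn_ge0.
  lra.
- have -> : series (fun n => C * `|A n * (2 * x) ^+ n|) =
     (fun N => C * series (fun n => `|A n * (2 * x) ^+ n|) N).
    by apply/funext => N; rewrite !seriesEnat /= mulr_sumr.
  by apply: is_cvgM; [exact: is_cvg_cst|exact: eA].
Qed.

Lemma cvgry_powR (R : realType) (g : R -> R) (s : R) : 0 < s ->
  g x @[x --> +oo] --> +oo -> g x `^ s @[x --> +oo] --> +oo.
Proof.
move=> s0 gy; apply/cvgryPge => M; near=> x.
apply: le_trans (ler_norm M) _.
have -> : `|M| = (`|M| `^ s^-1) `^ s.
  by rewrite -powRrM mulVf ?gt_eqF // powRr1.
have gM : `|M| `^ s^-1 <= g x by near: x; apply: (cvgryPge _).1 gy _.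
apply: ge0_ler_powR => //; rewrite ?nnegrE ?powR_ge0 ?(ltW s0) //.
exact: le_trans (powR_ge0 _ _) gM.
Unshelve. all: end_near. Qed.

Lemma superpoly_peaked_of_ratio (R : realType) (A : nat -> R) (h kap K : R) :
  (forall n, 0 < A n) -> 0 < h -> 1 <= kap -> 0 <= K ->
  (forall n, `|h * A n / A n.+1 - n.+1%:R `^ kap| <= K * n.+1%:R `^ (kap - 1)) ->
  superpoly_peaked A (fun x => (h * x) `^ kap^-1).
Proof.
move=> A0 h0 k1 K0 hA.
have eA : entire_series A by exact: entire_series_of_ratio hA.
split=> // c k sc.
have k0 : 0 < kap by exact: lt_le_trans k1.
pose rho n : R := if n is m.+1 then h * A m / A m.+1 else 0.
have rge0 n : 0 <= rho n.
  by case: n => [|n] //=; rewrite divr_ge0 ?mulr_ge0 // ltW.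
have hr n : `|rho n - n%:R `^ kap| <= K * n%:R `^ (kap - 1).
  case: n => [|n]; last exact: hA.
  by rewrite /= powR0 ?gt_eqF // subrr normr0 mulr_ge0 ?powR_ge0.
have [C2 C20 h2] := @second_moment_bound R kap K rho k1 K0 (erefl _) rge0 hr.
have [C1 C10 h1] := @pointwise_bound R c k sc.
have [Ba _ hBa] := subpoly_mul_ln_bound k sc.
(* The exponent 0 removes the logarithm and bounds [c n] alone. *)
have [Bb _ hBb] := subpoly_mul_ln_bound 0 sc.
pose E := C1 * (1 + 2 * C2).
have E0 : 0 <= E by rewrite mulr_ge0 // addr_ge0 // mulr_ge0.
pose f x := (h * x) `^ kap^-1.
have main x : 0 < x -> 1 <= f x -> C2 <= f x ->
  `|(sum_from 1 (fun n => A n * c n * ln n%:R ^+ k * x ^+ n)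
     - sum_from 1 (fun n => A n * c n * x ^+ n) * ln (f x) ^+ k)
    / sum_from 0 (fun n => A n * x ^+ n)| <= E * (f x) `^ (- 4^-1).
  move=> x0; move fE : (f x) => F F1 CF.
  have F0 : 0 < F by exact: lt_le_trans F1.
  pose t n := A n * x ^+ n.
  have t0 n : 0 <= t n by rewrite mulr_ge0 ?exprn_ge0 // ltW.
  have FK : F `^ kap = h * x.
    by rewrite -fE /f -powRrM mulVf ?gt_eqF // powRr1 // mulr_ge0 // ltW.
  have ht n : rho n.+1 * t n.+1 = F `^ kap * t n.
    by rewrite FK /rho /t exprS; field; rewrite gt_eqF.
  have ct : cvgn (series t).
    have -> : t = (fun n => `|A n * x ^+ n|).
      by apply/funext => n; rewrite [RHS](ger0_norm (t0 n)).
    exact: eA.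
  have Tnd : {homo series t : n m / (n <= m)%N >-> n <= m}.
    by apply/nondecreasing_seqP => n; rewrite seriesSr lerDl t0.
  set T := sum_from 0 _.
  have TE : T = limn (series t) by rewrite /T /sum_from seriesEnat.
  have T0 : 0 < T.
    rewrite TE; apply: lt_le_trans (nondecreasing_cvgn_le Tnd ct 1%N).
    by rewrite seriesEnat /= big_nat1 /t expr0 mulr1.
  have cT : series t n @[n --> \oo] --> T by rewrite TE.
  have ca : cvgn (fun N => \sum_(1 <= n < N) A n * c n * ln n%:R ^+ k * x ^+ n).
    rewrite (_ : (fun N => _) =
      fun N => \sum_(1 <= n < N) A n * (c n * ln n%:R ^+ k) * x ^+ n).
      exact: entire_series_mul_cvg hBa.
    by apply/funext => N; apply: eq_bigr => n _; rewrite !mulrA.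
  have cb : cvgn (fun N => \sum_(1 <= n < N) A n * c n * x ^+ n).
    apply: (@entire_series_mul_cvg _ _ _ Bb) => // n n1.
    by have := hBb n n1; rewrite expr0 mulr1.
  rewrite normrM normfV (gtr0_norm T0) ler_pdivrMr //.
  pose L := ln F ^+ k.
  pose D N := \sum_(1 <= n < N) A n * c n * ln n%:R ^+ k * x ^+ n
              - (\sum_(1 <= n < N) A n * c n * x ^+ n) * L.
  have cD : D N @[N --> \oo] -->
      sum_from 1 (fun n => A n * c n * ln n%:R ^+ k * x ^+ n)
     - sum_from 1 (fun n => A n * c n * x ^+ n) * L.
    by apply: cvgB => //; apply: cvgM => //; exact: cvg_cst.
  (* In terms of [d] the powers [F^(1/4)] and [1 / F] become [1 / d] and [d ^+ 4], so the later
     identities are rational in [d]. *)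
  pose d := F `^ (- 4^-1).
  have d0 : 0 < d by exact: powR_gt0.
  have d1 : d <= 1 by rewrite -[leRHS](powRr0 F) ler_powR //; lra.
  have dE : F `^ 4^-1 = d^-1 by rewrite /d powRN invrK.
  have d4 : d ^+ 4 = F^-1.
    rewrite -powR_mulrn ?powR_ge0 // -powRrM mulNr mulVf ?powR_inv1 ?(ltW F0) //.
  have bd N : `|D N.+1| <= E * d * series t N.+1 + 8 * C1 / d ^+ 3 * t N.
    pose w n : R := n%:R / F - 1.
    have -> : D N.+1 = \sum_(1 <= n < N.+1)
        t n * (c n * ln n%:R ^+ k - c n * ln F ^+ k).
      rewrite /D mulr_suml -sumrB; apply: eq_bigr => n _.
      by rewrite /t /L; ring.
    apply: le_trans (ler_norm_sum _ _ _) _.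
    (* The weights of this arithmetic-geometric mean inequality balance the two terms: [w ^+ 2] has
       mean O([d ^+ 4]), so both have mean O([d ^+ 2]), and the factor [F^(1/4) = 1 / d] leaves
       O([d]). *)
    have term n : `|w n| + w n ^+ 2 <= d ^+ 2 + 2 / d ^+ 2 * w n ^+ 2.
      have e0 : d != 0 by rewrite gt_eqF.
      have dd : 1 <= d ^- 2 by rewrite -exprVn expr_ge1 ?invf_ge1 // invr_ge0 ltW.
      have := sqr_ge0 (d - `|w n| / d).
      have -> : (d - `|w n| / d) ^+ 2 = d ^+ 2 - 2 * `|w n| + d ^- 2 * `|w n| ^+ 2.
        by field.
      rewrite real_normK ?num_real //.
      have : 1 * w n ^+ 2 <= d ^- 2 * w n ^+ 2 by rewrite ler_wpM2r ?sqr_ge0.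
      have := sqr_ge0 d; have := sqr_ge0 (w n); rewrite -[2 / d ^+ 2 * _]mulrA.
      set X := d ^- 2 * w n ^+ 2; set Y := d ^+ 2; lra.
    have Cd : 0 <= C1 / d by rewrite divr_ge0 // ltW.
    (* The nonnegative term at index 0 is added, so that [second_moment_bound] applies. *)
    apply: (@le_trans _ _ (\sum_(0 <= n < N.+1)
        C1 / d * (d ^+ 2 * t n + 2 / d ^+ 2 * (w n ^+ 2 * t n)))).
      rewrite [leRHS]big_ltn //= -[leLHS]add0r; apply: lerD.
        apply: mulr_ge0 => //; apply: addr_ge0; first by rewrite mulr_ge0 // sqr_ge0.
        apply: mulr_ge0; first by rewrite divr_ge0 // sqr_ge0.
        by rewrite mulr_ge0 // sqr_ge0.
      rewrite big_nat_cond [leRHS]big_nat_cond; apply: ler_sum => n /andP[/andP[n1 _] _].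
      rewrite normrM (ger0_norm (t0 n)).
      have := h1 F n F1 n1; rewrite -/(w n) dE => hp.
      have {}hp : `|c n * ln n%:R ^+ k - c n * ln F ^+ k| <=
          C1 / d * (d ^+ 2 + 2 / d ^+ 2 * w n ^+ 2).
        by apply: le_trans hp _; rewrite ler_wpM2l.
      have : t n * `|c n * ln n%:R ^+ k - c n * ln F ^+ k| <=
          t n * (C1 / d * (d ^+ 2 + 2 / d ^+ 2 * w n ^+ 2)) by rewrite ler_wpM2l.
      move/le_trans; apply; rewrite le_eqVlt; apply/orP; left; apply/eqP; ring.
    rewrite -mulr_sumr big_split /= -!mulr_sumr.
    have hw : \sum_(0 <= n < N.+1) w n ^+ 2 * t n <=
        C2 * d ^+ 4 * \sum_(0 <= n < N.+1) t n + 4 * t N.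
      by rewrite d4; exact: h2.
    have : C1 / d * (2 / d ^+ 2) * \sum_(0 <= n < N.+1) w n ^+ 2 * t n <=
        C1 / d * (2 / d ^+ 2) *
        (C2 * d ^+ 4 * \sum_(0 <= n < N.+1) t n + 4 * t N).
      by apply: ler_wpM2l hw; rewrite mulr_ge0 // divr_ge0 // sqr_ge0.
    rewrite seriesEnat /=; set X := \sum_(0 <= n < _) t n.
    have -> : C1 / d * (2 / d ^+ 2) * (C2 * d ^+ 4 * X + 4 * t N) =
        2 * C1 * C2 * d * X + 8 * C1 / d ^+ 3 * t N.
      by field; rewrite gt_eqF.
    have -> : E * d * X = C1 / d * (d ^+ 2 * X) + 2 * C1 * C2 * d * X.
      by rewrite /E; field; rewrite gt_eqF.
    lra.
  (* With [x] fixed, the boundary term disappears because [t N] is the general term of a convergent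
     series. *)
  have ub : E * d * series t N.+1 + 8 * C1 / d ^+ 3 * t N @[N --> \oo]
      --> E * d * T + 8 * C1 / d ^+ 3 * 0.
    apply: cvgD; apply: cvgM; try exact: cvg_cst.
      by rewrite (cvg_shiftS (series t)).
    exact: cvg_series_cvg_0.
  rewrite mulr0 addr0 in ub.
  have cDn : `|D N.+1| @[N --> \oo] --> `|sum_from 1 (fun n => A n * c n * ln n%:R ^+ k * x ^+ n)
     - sum_from 1 (fun n => A n * c n * x ^+ n) * L|.
    by apply: cvg_norm; rewrite (cvg_shiftS D).
  by apply: (ler_cvg_to cDn ub); near=> N; exact: bd.
have fy : f x @[x --> +oo] --> +oo.
  apply: cvgry_powR; first by rewrite invr_gt0.
  by apply: gt0_cvgMry.
have hd : E * f x `^ (- 4^-1) @[x --> +oo] --> 0.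
  rewrite -[X in _ --> X](mulr0 E); apply: cvgM; first exact: cvg_cst.
  rewrite (_ : (fun x => _) = fun x => (f x `^ 4^-1)^-1); last first.
    by apply/funext => x; rewrite powRN.
  apply/gtr0_cvgV0; last by apply: cvgry_powR.
  near=> x; rewrite powR_gt0 //; apply: (@lt_le_trans _ _ 1) => //.
  by near: x; apply: (cvgryPge _).1 fy _.
apply/norm_cvg0P; apply: (@squeeze_cvgr _ _ _ _ (fun=> 0) (fun x => E * f x `^ (- 4^-1))).
- near=> x; rewrite normr_ge0 /=; apply: main.
  + by near: x; apply: nbhs_pinfty_gt; rewrite num_real.
  + by near: x; apply: (cvgryPge _).1 fy _.
  + by near: x; apply: (cvgryPge _).1 fy _.
- exact: cvg_cst.
- exact: hd.
Unshelve. all: end_near. Qed.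

Theorem theorem4 (R : realType) (p q : nat)
    (alpha a : 'I_p -> R) (beta b : 'I_q -> R)
    (alpha_gt0 : forall r : 'I_p, 0 < alpha r)
    (a_gt0 : forall r : 'I_p, 0 < a r)
    (beta_gt0 : forall r : 'I_q, 0 < beta r)
    (b_gt0 : forall r : 'I_q, 0 < b r)
    (kappa_ge1 : 1 <= gamma_kappa alpha beta) :
  superpoly_peaked (gamma_coeff alpha a beta b)
    (fun x : R =>
       (gamma_h alpha beta * x) `^ (gamma_kappa alpha beta)^-1).
Proof.
have [C C0 hC] := ln_gamma_coeff_ratio alpha_gt0 a_gt0 beta_gt0 b_gt0.
have h0 := gamma_h_gt0 alpha_gt0 beta_gt0.
have A0 n := @gamma_coeff_gt0 R p q alpha a beta b n alpha_gt0 a_gt0 beta_gt0 b_gt0.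
apply: (superpoly_peaked_of_ratio A0 h0 kappa_ge1 (K := C * expR C)).
  by rewrite mulr_ge0 ?expR_ge0.
move=> n; apply: powR_ratio_of_ln => //; first by rewrite ler1n.
exact: divr_gt0 (mulr_gt0 h0 (A0 n)) (A0 n.+1).
Qed.
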